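(* Let $s>0$. If $f\in\mathcal{P}$, then $$D'I_s'f(\underline{x})=I_{s+1}'D'f(\underline{x}).$$
   Context: Let $n\ge 1$ and let $\mathbb{R}[\underline{x}]$ be the ring of real polynomials in $\underline{x}=(x_1,\ldots,x_n)$. A linear operator on $\mathbb{R}[\underline{x}]$ is shift-invariant if it commutes with all translations $f(\underline{x})\mapsto f(\underline{x}+\underline{y})$. A multivariate delta operator is a tuple $(O_{x_1},\ldots,O_{x_n})$ of shift-invariant linear operators on $\mathbb{R}[\underline{x}]$ for which there is a constant $c\ne0$ with $O_{x_j}(x_k)=c\,\delta_{jk}$ for all $j,k$. Fix such a tuple, together with linear operators $x_1',\ldots,x_n'$ on $\mathbb{R}[\underline{x}]$ satisfying the Weyl--Heisenberg relations $[O_{x_j},O_{x_k}]=0=[x_j',x_k']$, $[O_{x_j},x_k']=\delta_{jk}\mathbf{id}$, where $[a,b]=ab-ba$. Let $C\ell_{0,n}$ be the real Clifford algebra generated by $\mathbf{e}_1,\ldots,\mathbf{e}_n$ with $\mathbf{e}_j\mathbf{e}_k+\mathbf{e}_k\mathbf{e}_j=-2\delta_{jk}$, and $\mathcal{P}=\mathbb{R}[\underline{x}]\otimes C\ell_{0,n}$. The operators $O_{x_j},x_j'$ act on the polynomial factor and $\mathbf{e}_j$ acts by left multiplication. Put $D'=\sum_j\mathbf{e}_jO_{x_j}$ and $E'=\sum_jx_j'O_{x_j}$, linear operators on $\mathcal{P}$. For $s>0$ the operator $E'+s\,\mathbf{id}$ is invertible on $\mathcal{P}$, and $I_s':\mathcal{P}\to\mathcal{P}$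 denotes its two-sided inverse. *)

(* Defs.v *)
From HB Require Import structures.
From Stdlib Require Import ClassicalEpsilon.
From mathcomp Require Import all_boot all_order all_algebra.
From mathcomp Require Import reals.
From mathcomp Require Import mpoly.

Set Implicit Arguments.
Unset Strict Implicit.
Unset Printing Implicit Defensive.

Import Order.TTheory GRing.Theory Num.Theory.
Local Open Scope ring_scope.

(** * The Clifford algebra Cl_{0,n}

    It is realized on the free module with basis e_A, A a subset of 'I_n, where
    e_A stands for the product of the e_i, i in A, in increasing order.
    Reordering e_A e_B takes one transposition for each pair i in A, j in B
    with j < i, and each i in both A and B contributes e_i^2 = -1; the
    remaining indices form the symmetric difference of A and B. *)

Section SymmetricDifference.
Variable n : nat.
Implicit Types A B C : {set 'I_n}.

Definition symdiff A B : {set 'I_n} := (A :\: B) :|: (B :\: A).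

Definition nswap A B : nat := (\sum_(i in A) #|[set j in B | (j <= i)%N]|)%N.

Lemma in_symdiff A B i : (i \in symdiff A B) = (i \in A) (+) (i \in B).
Proof. by rewrite !inE; case: (i \in A); case: (i \in B). Qed.

Lemma symdiffA : associative symdiff.
Proof. by move=> A B C; apply/setP=> i; rewrite !in_symdiff addbA. Qed.

Lemma symdiffK A : involutive (symdiff A).
Proof. by move=> B; apply/setP=> i; rewrite !in_symdiff addKb. Qed.

Lemma symdiff0s A : symdiff set0 A = A.
Proof. by apply/setP=> i; rewrite in_symdiff inE. Qed.

Lemma symdiffs0 A : symdiff A set0 = A.
Proof. by apply/setP=> i; rewrite in_symdiff inE addbF. Qed.

Lemma symdiffss A : symdiff A A = set0.
Proof. by apply/setP=> i; rewrite in_symdiff inE addbb. Qed.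

Lemma symdiffC A B : symdiff A B = symdiff B A.
Proof. by apply/setP=> i; rewrite !in_symdiff addbC. Qed.

Lemma odd_sum (F : 'I_n -> nat) :
  odd (\sum_i F i)%N = \big[addb/false]_i odd (F i).
Proof. by apply: (big_morph odd oddD). Qed.

Lemma nswapE A B :
  odd (nswap A B) =
  \big[addb/false]_i \big[addb/false]_j
     [&& i \in A, j \in B & (j <= i)%N].
Proof.
rewrite /nswap big_mkcond odd_sum; apply: eq_bigr => i _.
case: (i \in A) => /=; last by rewrite big1.
rewrite -sum1_card big_mkcond odd_sum; apply: eq_bigr => j _.
by rewrite !inE; case: ifP.
Qed.

Lemma odd_nswapDl A B C :
  odd (nswap (symdiff A B) C) = odd (nswap A C) (+) odd (nswap B C).
Proof.
rewrite !nswapE -big_split; apply: eq_bigr => i _ /=.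
rewrite -big_split; apply: eq_bigr => j _ /=; rewrite in_symdiff.
by case: (i \in A); case: (i \in B); rewrite /= ?addbb ?addbF.
Qed.

Lemma odd_nswapDr A B C :
  odd (nswap A (symdiff B C)) = odd (nswap A B) (+) odd (nswap A C).
Proof.
rewrite !nswapE -big_split; apply: eq_bigr => i _ /=.
rewrite -big_split; apply: eq_bigr => j _ /=; rewrite in_symdiff.
by case: (i \in A); case: (j \in B); case: (j \in C); rewrite /= ?addbb ?addbF.
Qed.

Lemma nswap0s A : nswap set0 A = 0%N.
Proof. by rewrite /nswap big_set0. Qed.

Lemma nswaps0 A : nswap A set0 = 0%N.
Proof. by rewrite /nswap big1 // => i _; apply: eq_card0 => j; rewrite !inE. Qed.

Lemma nswap1 i j : nswap [set i] [set j] = (j <= i)%N.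
Proof.
rewrite /nswap big_set1; case: (leqP j i) => ji /=.
  apply/eqP/cards1P; exists j; apply/setP=> k; rewrite !inE.
  by case: eqP => // ->.
by apply: eq_card0 => k; rewrite !inE; case: eqP => // ->; rewrite leqNgt ji.
Qed.

End SymmetricDifference.

Definition clifford (R : Type) (n : nat) : Type := {ffun {set 'I_n} -> R}.

Section Clifford.
Variables (R : comNzRingType) (n : nat).
Notation Cl := (clifford R n).
Implicit Types (a b c : Cl) (A B C : {set 'I_n}).

HB.instance Definition _ := GRing.Lmodule.copy Cl {ffun {set 'I_n} -> R^o}.

Definition cl_coef a A : R := (a : {ffun {set 'I_n} -> R}) A.

Definition cl_basis A : Cl := [ffun B => (B == A)%:R].

Definition cl_one : Cl := cl_basis set0.

Definition cl_mul a b : Cl :=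
  [ffun C => \sum_A \sum_(B | symdiff A B == C)
     (-1) ^+ nswap A B * (cl_coef a A * cl_coef b B)].

Lemma cl_ext a b : (forall A, cl_coef a A = cl_coef b A) -> a = b.
Proof. by move=> ab; apply/ffunP. Qed.

Lemma cl_coefD a b A : cl_coef (a + b) A = cl_coef a A + cl_coef b A.
Proof. exact: ffunE. Qed.

Lemma cl_coefZ (r : R) a A : cl_coef (r *: a) A = r * cl_coef a A.
Proof. exact: ffunE. Qed.

Lemma cl_coef_basis A B : cl_coef (cl_basis A) B = (B == A)%:R.
Proof. exact: ffunE. Qed.

Lemma cl_coefM a b C : cl_coef (cl_mul a b) C =
  \sum_A (-1) ^+ nswap A (symdiff A C) * (cl_coef a A * cl_coef b (symdiff A C)).
Proof.
rewrite {1}/cl_coef ffunE; apply: eq_bigr => A _.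
rewrite (big_pred1 (symdiff A C)) // => B.
by apply/eqP/eqP => [<-|->]; rewrite symdiffK.
Qed.

Fact cl_mulA : associative cl_mul.
Proof.
move=> a b c; apply: cl_ext => D; rewrite !cl_coefM.
transitivity (\sum_A \sum_B (-1) ^+ (nswap A (symdiff A D) +
    nswap B (symdiff B (symdiff A D))) *
    (cl_coef a A * (cl_coef b B * cl_coef c (symdiff B (symdiff A D))))).
  apply: eq_bigr => A _; rewrite cl_coefM !mulr_sumr; apply: eq_bigr => B _.
  by rewrite exprD (mulrCA (cl_coef a A)) !mulrA.
transitivity (\sum_C \sum_A (-1) ^+ (nswap C (symdiff C D) +
    nswap A (symdiff A C)) *
    (cl_coef a A * (cl_coef b (symdiff A C) * cl_coef c (symdiff C D)))); last first.
  apply: eq_bigr => C _; rewrite cl_coefM mulr_suml mulr_sumr.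
  by apply: eq_bigr => A _; rewrite exprD !mulrA.
rewrite [RHS]exchange_big; apply: eq_bigr => A _.
rewrite [RHS](reindex_inj (inv_inj (symdiffK A))); apply: eq_bigr => B _ /=.
rewrite symdiffK.
have -> : symdiff B (symdiff A D) = symdiff (symdiff A B) D.
  by rewrite symdiffA (symdiffC B).
congr (_ * _); rewrite -signr_odd -[RHS]signr_odd; congr (_ ^+ nat_of_bool _).
rewrite !oddD !odd_nswapDl !odd_nswapDr.
set x := odd (nswap A A); set y := odd (nswap A D); set z := odd (nswap A B).
set t := odd (nswap B A); set u := odd (nswap B B); set v := odd (nswap B D).
by case: x y z t u v => [] [] [] [] [] [].
Qed.

Fact cl_mul1l : left_id cl_one cl_mul.
Proof.
move=> a; apply: cl_ext => C; rewrite cl_coefM (bigD1 set0) //= big1.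
  by rewrite cl_coef_basis eqxx mul1r symdiff0s nswap0s mul1r addr0.
by move=> A A0; rewrite cl_coef_basis (negPf A0) mul0r mulr0.
Qed.

Fact cl_mul1r : right_id cl_one cl_mul.
Proof.
move=> a; apply: cl_ext => C; rewrite cl_coefM (bigD1 C) //= big1.
  by rewrite cl_coef_basis symdiffss eqxx mulr1 nswaps0 mul1r addr0.
move=> A AC; rewrite cl_coef_basis; case: eqP => [eq0|_]; last by rewrite !mulr0.
by rewrite -(symdiffK A C) eq0 symdiffs0 eqxx in AC.
Qed.

Fact cl_mulDl : left_distributive cl_mul +%R.
Proof.
move=> a b c; apply: cl_ext => C; rewrite cl_coefD !cl_coefM -big_split /=.
by apply: eq_bigr => A _; rewrite cl_coefD mulrDl mulrDr.
Qed.

Fact cl_mulDr : right_distributive cl_mul +%R.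
Proof.
move=> a b c; apply: cl_ext => C; rewrite cl_coefD !cl_coefM -big_split /=.
by apply: eq_bigr => A _; rewrite cl_coefD !mulrDr.
Qed.

Fact cl_one_neq0 : cl_one != 0.
Proof.
apply/eqP => /ffunP/(_ set0); rewrite !ffunE eqxx => /eqP.
by rewrite oner_eq0.
Qed.

HB.instance Definition _ := GRing.Zmodule_isNzRing.Build Cl
  cl_mulA cl_mul1l cl_mul1r cl_mulDl cl_mulDr cl_one_neq0.

Fact cl_scaleAl (r : R) (a b : Cl) : r *: (a * b) = (r *: a) * b.
Proof.
apply: cl_ext => C; rewrite cl_coefZ !cl_coefM mulr_sumr.
by apply: eq_bigr => A _; rewrite cl_coefZ mulrCA !mulrA.
Qed.

HB.instance Definition _ := GRing.Lmodule_isLalgebra.Build R Cl cl_scaleAl.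

Fact cl_scaleAr (r : R) (a b : Cl) : r *: (a * b) = a * (r *: b).
Proof.
apply: cl_ext => C; rewrite cl_coefZ !cl_coefM mulr_sumr.
apply: eq_bigr => A _; rewrite cl_coefZ mulrCA; congr (_ * _); exact: mulrCA.
Qed.

HB.instance Definition _ := GRing.Lalgebra_isAlgebra.Build R Cl cl_scaleAr.

Definition cl_gen (i : 'I_n) : Cl := cl_basis [set i].

Lemma cl_basisM A B :
  cl_basis A * cl_basis B = (-1) ^+ nswap A B *: cl_basis (symdiff A B).
Proof.
apply: cl_ext => C; rewrite cl_coefZ cl_coefM cl_coef_basis (bigD1 A) //= big1.
  rewrite !cl_coef_basis eqxx mul1r addr0.
  have -> : (symdiff A C == B) = (C == symdiff A B).
    by apply/eqP/eqP => [<-|->]; rewrite symdiffK.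
  by case: eqP => [->|_]; rewrite ?mulr0 ?symdiffK.
by move=> A' A'A; rewrite cl_coef_basis (negPf A'A) mul0r mulr0.
Qed.

Lemma cl_genM (j k : 'I_n) :
  cl_gen j * cl_gen k + cl_gen k * cl_gen j = - 2%:R *: ((j == k)%:R : Cl).
Proof.
rewrite /cl_gen !cl_basisM !nswap1 (symdiffC [set k]) -scalerDl.
case: eqVneq => [->|jk].
  by rewrite leqnn symdiffss expr1 -opprD.
rewrite scaler0; have := jk; rewrite -val_eqE neq_ltn /=.
by case/orP=> h; rewrite (ltnW h) leqNgt h /= ?addrN ?addNr scale0r.
Qed.

Lemma cl_basis_prod A : cl_basis A = \prod_(i <- enum A) cl_gen i.
Proof.
have /= : sorted ltn (map val (enum A)).
  apply: (@subseq_sorted _ _ ltn_trans _ (map val (enum 'I_n))).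
    by rewrite map_subseq // enumT filter_subseq.
  by rewrite val_enum_ord iota_ltn_sorted.
have -> : cl_basis A = cl_basis [set i in enum A].
  by congr cl_basis; apply/setP=> i; rewrite inE mem_enum.
elim: (enum A) => [_|i s IHs] /=.
  by rewrite big_nil -[1]/(cl_basis set0); congr cl_basis.
rewrite (path_sortedE ltn_trans) => /andP[/allP lt_i /IHs IH].
have i_s : i \notin s by apply/negP => /(map_f val)/lt_i /=; rewrite ltnn.
rewrite big_cons -IH cl_basisM.
have -> : nswap [set i] [set j in s] = 0%N.
  rewrite /nswap big_set1; apply: eq_card0 => j; rewrite !inE.
  by apply/negP => /andP[/(map_f val)/lt_i /=]; rewrite ltnNge => /negPf->.
rewrite scale1r; congr cl_basis; apply/setP=> j.
by rewrite in_symdiff !inE; case: eqP => // ->; rewrite (negPf i_s).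
Qed.

End Clifford.

(** * The module R[x] (x) Cl_{0,n}

    An element of the tensor product is given by its coordinates, which are
    polynomials, in the basis (e_A)_A of the Clifford algebra. *)

Notation clpoly R n := {ffun {set 'I_n} -> {mpoly R[n]}}.

Section ClPoly.
Variables (R : comNzRingType) (n : nat).
Implicit Types (p : {mpoly R[n]}) (a b : clifford R n) (f : clpoly R n).

Definition clpoly_tensor p a : clpoly R n := [ffun A => cl_coef a A *: p].

(* T (x) id *)
Definition clpoly_op (T : {mpoly R[n]} -> {mpoly R[n]}) f : clpoly R n :=
  [ffun A => T (f A)].

(* id (x) (left multiplication by a) *)
Definition clpoly_lmul a f : clpoly R n :=
  [ffun B => \sum_A cl_coef (a * cl_basis R A) B *: f A].

Lemma clpoly_op_tensor (T : {linear {mpoly R[n]} -> {mpoly R[n]}}) p a :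
  clpoly_op T (clpoly_tensor p a) = clpoly_tensor (T p) a.
Proof. by apply/ffunP=> A; rewrite !ffunE linearZ. Qed.

Lemma cl_coefM_basis a b B :
  cl_coef (a * b) B = \sum_A cl_coef b A * cl_coef (a * cl_basis R A) B.
Proof.
have {1}-> : b = \sum_A cl_coef b A *: cl_basis R A.
  apply: cl_ext => C; rewrite {2}/cl_coef sum_ffunE (bigD1 C) //= big1.
    by rewrite -/(cl_coef _ _) cl_coefZ cl_coef_basis eqxx mulr1 addr0.
  move=> A AC; rewrite -/(cl_coef _ _) cl_coefZ cl_coef_basis.
  by rewrite eq_sym (negPf AC) mulr0.
rewrite mulr_sumr {1}/cl_coef sum_ffunE; apply: eq_bigr => A _.
by rewrite -scalerAr -/(cl_coef _ _) cl_coefZ.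
Qed.

Lemma clpoly_lmul_tensor a p b :
  clpoly_lmul a (clpoly_tensor p b) = clpoly_tensor p (a * b).
Proof.
apply/ffunP=> B; rewrite !ffunE cl_coefM_basis scaler_suml.
by apply: eq_bigr => A _; rewrite !ffunE scalerA mulrC.
Qed.

Lemma clpoly_sum_tensor f : f = \sum_A clpoly_tensor (f A) (cl_basis R A).
Proof.
apply/ffunP=> B; rewrite sum_ffunE (bigD1 B) //= big1.
  by rewrite ffunE cl_coef_basis eqxx scale1r addr0.
by move=> A AB; rewrite ffunE cl_coef_basis eq_sym (negPf AB) scale0r.
Qed.

End ClPoly.

(** * Delta operators and the operators D', E', I_s' *)

Section Operators.
Variables (R : realType) (n : nat).
Notation pol := {mpoly R[n]}.
Implicit Types (T : pol -> pol) (O X : 'I_n -> {linear pol -> pol}).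

Definition translate (y : 'I_n -> R) (p : pol) : pol :=
  p \mPo [tuple 'X_i + (y i)%:MP | i < n].

Definition shift_invariant T : Prop :=
  forall (y : 'I_n -> R) (p : pol), T (translate y p) = translate y (T p).

Definition delta_operator O : Prop :=
  (forall j, shift_invariant (O j)) /\
  exists2 c : R, c != 0 & forall j k, O j 'X_k = (c * (j == k)%:R)%:MP.

Definition comm_op (S T : pol -> pol) (p : pol) : pol := S (T p) - T (S p).

Definition weyl_heisenberg O X : Prop :=
  [/\ forall j k p, comm_op (O j) (O k) p = 0,
      forall j k p, comm_op (X j) (X k) p = 0
    & forall j k p, comm_op (O j) (X k) p = (j == k)%:R *: p].

Definition D' O (f : clpoly R n) : clpoly R n :=
  \sum_j clpoly_lmul (cl_gen R j) (clpoly_op (O j) f).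

Definition E' O X (f : clpoly R n) : clpoly R n :=
  \sum_j clpoly_op (X j) (clpoly_op (O j) f).

Definition two_sided_inverse (U : Type) (S T : U -> U) : Prop :=
  cancel S T /\ cancel T S.

(* The two-sided inverse of E' + s id. It is unique when it exists, and it
   exists when s > 0, O is a delta operator and O, X satisfy the
   Weyl-Heisenberg relations. *)
Definition I' O X (s : R) : clpoly R n -> clpoly R n :=
  epsilon (inhabits id)
    (two_sided_inverse (fun f : clpoly R n => E' O X f + s *: f)).

End Operators.

(* Main.v *)
Require Import Defs.
From HB Require Import structures.
From Stdlib Require Import ClassicalEpsilon.
From mathcomp Require Import all_boot all_order all_algebra.
From mathcomp Require Import reals.
From mathcomp Require Import mpoly.

Set Implicit Arguments.
Unset Strict Implicit.
Unset Printing Implicit Defensive.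

Import Order.TTheory GRing.Theory Num.Theory.
Local Open Scope ring_scope.

(** The identity is D'(E' + s) = (E' + s + 1)D' read through the inverses of
    E' + s and E' + s + 1, and that intertwining relation only uses
    O_j E = (E + 1)O_j, where E = sum_k X_k O_k acts on one polynomial. Since
    [I'] is obtained by a choice operator, the substance is that these inverses
    exist ([I'_inverse]).

    The operators O_j strictly lower the degree ([delta_operator_msize]). A
    shift-invariant operator commutes with every partial derivative, by
    comparing the terms linear in t in its commutation with the translation
    x_j |-> x_j + t ([shift_invariant_mderiv]). In particular O_j maps 1, the
    derivative of x_j, to that of the constant O_j x_j, which is 0; this starts
    an induction on the degree, since in characteristic 0 the degree of a
    nonconstant polynomial can be read on its partial derivatives. So each polynomial is killed by all products of d
    operators O_j, for some d.

    The invertibility of E + s for all s > 0 then follows from the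
    Weyl-Heisenberg relations, by induction on d with s varying. If (E + s)v = 0, then
    (E + s + 1)O_j v = O_j(E + s)v = 0, hence O_j v = 0 for all j, E v = 0
    and s v = 0 ([euler_shift_inj]). To reach v, take q_j with
    (E + s + 1)q_j = O_j v; as E X_j = X_j(E + 1), the sum w of the X_j q_j
    satisfies (E + s)w = E v, so that (E + s)(v - w) = s v
    ([euler_shift_surj]). *)

(** * Shift-invariant operators commute with partial derivatives *)

(** The translation parameter t is made an indeterminate: the translate of p
    along the j-th axis is a polynomial in t over the polynomial ring, whose
    first two coefficients are those of the Taylor formula. Such expansions are
    stable under sums and products (the Leibniz rule is the coefficient of t in
    a product), so that the variables and the constants suffice. *)
Lemma translate_line_expansion (R : realType) (n : nat) (j : 'I_n)
    (p : {mpoly R[n]}) :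
  exists P : {poly {mpoly R[n]}},
    [/\ forall t : R, translate (fun i => t * (i == j)%:R) p = P.[t%:MP],
        P`_0 = p & P`_1 = mderiv j p].
Proof.
pose expandable (q : {mpoly R[n]}) := exists P : {poly {mpoly R[n]}},
    [/\ forall t : R, translate (fun i => t * (i == j)%:R) q = P.[t%:MP],
        P`_0 = q & P`_1 = mderiv j q].
have expC c : expandable c%:MP.
  exists (c%:MP)%:P; split=> [t||]; rewrite ?coefC ?mderivC //.
  by rewrite /translate comp_mpolyC hornerC.
have expD p1 p2 : expandable p1 -> expandable p2 -> expandable (p1 + p2).
  move=> [P1 [T1 c10 c11]] [P2 [T2 c20 c21]]; exists (P1 + P2); split=> [t||].
  - by rewrite hornerD -T1 -T2 /translate comp_mpolyD.
  - by rewrite coefD c10 c20.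
  - by rewrite coefD c11 c21 mderivD.
have expM p1 p2 : expandable p1 -> expandable p2 -> expandable (p1 * p2).
  move=> [P1 [T1 c10 c11]] [P2 [T2 c20 c21]]; exists (P1 * P2); split=> [t||].
  - by rewrite hornerM -T1 -T2 /translate rmorphM.
  - by rewrite coefM big_ord1 c10 c20.
  - by rewrite coefM 2!big_ord_recl big_ord0 c10 c20 c11 c21 mderivM addr0 addrC.
have expX i : expandable 'X_i.
  exists (('X_i)%:P + (i == j)%:R *: 'X); split=> [t||].
  - rewrite /translate comp_mpolyXU -tnth_nth tnth_mktuple !hornerE.
    by case: (i == j); rewrite ?mulr1 ?mulr0 ?mul1r ?mul0r ?mpolyC0.
  - by rewrite coefD coefC coefZ coefX mulr0 addr0.
  - rewrite coefD coefC coefZ coefX mulr1 add0r mderivX mnm1E.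
    case: eqP => [->|_]; last by rewrite scale0r.
    by rewrite -[X in (X - _)%MM]add0m addmK mpolyX0 scale1r.
elim/mpolyind: p => [|c m p _ _ IHp]; first by have := expC 0; rewrite mpolyC0.
apply: expD IHp; rewrite -mul_mpolyC; apply: (expM _ _ (expC c)).
rewrite mpolyXE_id; have exp1 : expandable 1 by rewrite -mpolyC1.
apply: (big_ind _ exp1 expM) => i _.
by elim: (m i) => [|k IHk]; rewrite ?expr0 ?exprS //; apply: expM.
Qed.

(** The scalars already provide infinitely many points of the integral domain
    of multivariate polynomials. *)
Lemma poly_eq_on_scalars (R : numDomainType) (n : nat)
    (P Q : {poly {mpoly R[n]}}) :
  (forall t : R, P.[t%:MP] = Q.[t%:MP]) -> P = Q.
Proof.
move=> PQ; apply/eqP; rewrite -subr_eq0; apply: contraT => nz.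
pose s := [seq (k%:R : R)%:MP_[n] | k <- iota 0 (size (P - Q))].
have : (size s < size (P - Q)%R)%N.
  apply: max_poly_roots nz _ _.
    by apply/allP=> _ /mapP[k _ ->]; rewrite rootE hornerD hornerN PQ subrr.
  rewrite map_inj_uniq ?iota_uniq // => k l /eqP.
  by rewrite mpolyC_eq eqr_nat => /eqP.
by rewrite size_map size_iota ltnn.
Qed.

(** T, being linear over the scalars t, maps the expansion of p
    coefficientwise to that of T p; the coefficients of t are then equal. *)
Lemma shift_invariant_mderiv (R : realType) (n : nat)
    (T : {linear {mpoly R[n]} -> {mpoly R[n]}}) (j : 'I_n) (p : {mpoly R[n]}) :
  shift_invariant T -> T (mderiv j p) = mderiv j (T p).
Proof.
move=> shT; have [P [TP _ <-]] := translate_line_expansion j p.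
have [Q [TQ _ <-]] := translate_line_expansion j (T p).
rewrite -(coef_map T); congr (polyseq _)`_1.
apply: poly_eq_on_scalars => t; rewrite -TQ -shT TP.
rewrite (horner_coef_wide _ (size_poly _ _)) horner_coef linear_sum.
apply: eq_bigr => k _ /=; rewrite coef_map /=.
by rewrite -rmorphXn /= !(mulrC _ (_%:MP)) !mul_mpolyC linearZ.
Qed.

(** * Delta operators lower the degree *)

Lemma msize_mderiv (R : nzRingType) (n d : nat) (j : 'I_n) (q : {mpoly R[n]}) :
  (msize q <= d.+1)%N -> (msize (mderiv j q) <= d)%N.
Proof.
move=> le_q; rewrite msizeE; apply/bigmax_leqP_seq => m.
rewrite mcoeff_msupp mcoeff_deriv => mq _.
have {mq} : (m + U_(j))%MM \in msupp q.
  by rewrite mcoeff_msupp; apply: contraNneq mq => ->; rewrite mul0rn.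
by move/msize_mdeg_lt; rewrite mdegD mdeg1 addn1 => /leq_trans/(_ le_q).
Qed.

(** Characteristic 0 is essential: a monomial m containing x_j contributes
    m_j times its coefficient to the derivative, and this must not vanish. *)
Lemma msize_le_mderiv (R : numDomainType) (n d : nat) (q : {mpoly R[n]}) :
  (forall j, (msize (mderiv j q) <= d)%N) -> (msize q <= d.+1)%N.
Proof.
move=> hq; rewrite msizeE; apply/bigmax_leqP_seq => m mq _.
rewrite ltnS leqNgt; apply/negP => dm.
have [j mj] : exists j, (0 < m j)%N.
  apply/existsP; rewrite -[X in is_true X]negbK negb_exists.
  apply/negP => /forallP m0; move: dm; rewrite mdegE big1 // => i _.
  by apply/eqP; rewrite -leqn0 leqNgt m0.
have eqm : (m - U_(j) + U_(j) = m)%MM.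
  by rewrite submK //; apply/mnm_lepP=> i; rewrite mnm1E; case: eqP => // <-.
have: (m - U_(j))%MM \in msupp (mderiv j q).
  by rewrite mcoeff_msupp mcoeff_deriv eqm mulrn_eq0 -mcoeff_msupp mq.
move/msize_mdeg_lt/leq_trans/(_ (hq j)).
by move: dm; rewrite -{1}eqm mdegD mdeg1 addn1 ltnS leqNgt => /negPf->.
Qed.

(** The partial derivatives of T p are the images under T of those of p, which
    have smaller degree; the induction starts from the constants, where
    T 1 = 0 is used. *)
Lemma shift_invariant_msize (R : realType) (n d : nat)
    (T : {linear {mpoly R[n]} -> {mpoly R[n]}}) (p : {mpoly R[n]}) :
  shift_invariant T -> T 1 = 0 ->
  (msize p <= d.+1)%N -> (msize (T p) <= d)%N.
Proof.
move=> shT T1; elim: d p => [|d IHd] p le_p.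
  by rewrite (msize1_polyC le_p) -[_%:MP]mulr1 mul_mpolyC linearZ /= T1 scaler0
    msize0.
apply: msize_le_mderiv => j; rewrite -shift_invariant_mderiv //.
exact/IHd/msize_mderiv.
Qed.

(** O_j 1 = 0 because 1 is the j-th derivative of x_j, O_j commutes with that
    derivative, and O_j x_j is constant. *)
Lemma delta_operator_msize (R : realType) (n d : nat)
    (O : 'I_n -> {linear {mpoly R[n]} -> {mpoly R[n]}}) (j : 'I_n)
    (p : {mpoly R[n]}) :
  delta_operator O -> (msize p <= d.+1)%N -> (msize (O j p) <= d)%N.
Proof.
move=> [shO [c _ OX]]; apply: shift_invariant_msize => //.
have <- : mderiv j 'X_j = 1 :> {mpoly R[n]}.
  by rewrite mderivX mnm1E eqxx scale1r -[X in (X - _)%MM]add0m addmK mpolyX0.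
by rewrite shift_invariant_mderiv // OX mderivC.
Qed.

(** * Invertibility of the shifted Euler operator *)

Definition euler_op (K : nzRingType) (V : lmodType K) (n : nat)
    (O X : 'I_n -> {linear V -> V}) (v : V) : V := \sum_j X j (O j v).

(** All products of d of the operators O_j kill v. The recursion on d is the
    form in which this joint nilpotence serves as an induction principle. *)
Fixpoint annihilated (V : zmodType) (n : nat) (O : 'I_n -> V -> V) (d : nat)
    (v : V) : Prop :=
  if d is d'.+1 then forall j, annihilated O d' (O j v) else v = 0.

Lemma euler_op_is_linear (K : nzRingType) (V : lmodType K) (n : nat)
    (O X : 'I_n -> {linear V -> V}) : linear (euler_op O X).
Proof.
move=> a u v; rewrite /euler_op scaler_sumr -big_split.
by apply: eq_bigr => j _; rewrite /= !linearP.
Qed.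

HB.instance Definition _ (K : nzRingType) (V : lmodType K) (n : nat)
    (O X : 'I_n -> {linear V -> V}) :=
  GRing.isLinear.Build K V V _ (euler_op O X) (euler_op_is_linear O X).

(** O_j lowers the eigenvalues of the Euler operator by one: moving O_j to
    the right past X_k leaves an extra term, for k = j only. *)
Lemma lowering_euler (K : nzRingType) (V : lmodType K) (n : nat)
    (O X : 'I_n -> {linear V -> V}) (j : 'I_n) (v : V) :
  (forall j k u, O j (O k u) = O k (O j u)) ->
  (forall j k u, O j (X k u) = X k (O j u) + (j == k)%:R *: u) ->
  O j (euler_op O X v) = euler_op O X (O j v) + O j v.
Proof.
move=> OO OX; rewrite /euler_op linear_sum.
rewrite (eq_bigr (fun k => X k (O k (O j v)) + (j == k)%:R *: O k v)); last first.
  by move=> k _; rewrite OX OO.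
rewrite big_split /=; congr (_ + _); rewrite (bigD1 j) //= big1 ?addr0.
  by rewrite eqxx scale1r.
by move=> k /negPf; rewrite eq_sym => ->; rewrite scale0r.
Qed.

(** X_j raises the eigenvalues of the Euler operator by one. *)
Lemma euler_raising (K : nzRingType) (V : lmodType K) (n : nat)
    (O X : 'I_n -> {linear V -> V}) (j : 'I_n) (v : V) :
  (forall j k u, X j (X k u) = X k (X j u)) ->
  (forall j k u, O j (X k u) = X k (O j u) + (j == k)%:R *: u) ->
  euler_op O X (X j v) = X j (euler_op O X v) + X j v.
Proof.
move=> XX OX; rewrite /euler_op linear_sum.
rewrite (eq_bigr (fun k => X j (X k (O k v)) + (k == j)%:R *: X k v)); last first.
  by move=> k _; rewrite OX linearD linearZ XX.
rewrite big_split /=; congr (_ + _); rewrite (bigD1 j) //= big1 ?addr0.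
  by rewrite eqxx scale1r.
by move=> k /negPf->; rewrite scale0r.
Qed.

(** The shift s grows in the induction: O_j v is killed by E + (s + 1), so
    it is 0, and then E v = 0. *)
Lemma euler_shift_inj (K : numFieldType) (V : lmodType K) (n d : nat)
    (O X : 'I_n -> {linear V -> V}) (s : K) (v : V) :
  (forall j k u, O j (O k u) = O k (O j u)) ->
  (forall j k u, O j (X k u) = X k (O j u) + (j == k)%:R *: u) ->
  0 < s -> annihilated O d v -> euler_op O X v + s *: v = 0 -> v = 0.
Proof.
move=> OO OX; elim: d s v => [//|d IHd] s v s0 Ov ev.
have Ov0 j : O j v = 0.
  apply: (IHd (s + 1)) => //; first by rewrite addr_gt0.
  rewrite -[RHS](linear0 (O j)) -ev linearD linearZ /= lowering_euler //.
  by rewrite scalerDl scale1r -addrA (addrC (O j v)).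
have E0 : euler_op O X v = 0.
  by apply: big1 => j _; rewrite Ov0 linear0.
by move/eqP: ev; rewrite E0 add0r scaler_eq0 gt_eqF // => /eqP.
Qed.

(** The preimage of v is sought in the form (v - w) / s with (E + s)w = E v,
    since then (E + s)(v - w) = s v. Preimages q_j of the O_j v under
    E + (s + 1) give such a w, because X_j O_j v = X_j(E + s + 1)q_j
    = (E + s)X_j q_j. *)
Lemma euler_shift_surj (K : numFieldType) (V : lmodType K) (n d : nat)
    (O X : 'I_n -> {linear V -> V}) (s : K) (v : V) :
  (forall j k u, X j (X k u) = X k (X j u)) ->
  (forall j k u, O j (X k u) = X k (O j u) + (j == k)%:R *: u) ->
  0 < s -> annihilated O d v -> exists w, euler_op O X w + s *: w = v.
Proof.
move=> XX OX; elim: d s v => [|d IHd] s v s0 Ov.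
  by exists 0; rewrite linear0 scaler0 addr0 (Ov : v = 0).
have /fin_all_exists[q qP] j :
    exists w, euler_op O X w + (s + 1) *: w = O j v.
  by apply: IHd => //; rewrite addr_gt0.
pose w := \sum_j X j (q j).
have wP : euler_op O X w + s *: w = euler_op O X v.
  rewrite linear_sum scaler_sumr -big_split; apply: eq_bigr => j _ /=.
  by rewrite euler_raising // -qP linearD linearZ /= scalerDl scale1r addrAC addrA.
exists (s^-1 *: (v - w)).
rewrite linearZ /= scalerA mulrC -scalerA -scalerDr linearB scalerBr /=.
by rewrite addrACA -opprD wP addrAC subrr add0r scalerA mulVf ?gt_eqF ?scale1r.
Qed.

(** * The operators on Clifford-valued polynomials *)

Lemma E'_coord (R : realType) (n : nat)
    (O X : 'I_n -> {linear {mpoly R[n]} -> {mpoly R[n]}}) (f : clpoly R n)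
    (A : {set 'I_n}) :
  E' O X f A = euler_op O X (f A).
Proof. by rewrite sum_ffunE; apply: eq_bigr => j _; rewrite !ffunE. Qed.

(** The choice operator only returns an inverse if there is one. *)
Lemma bijective_epsilon (U : Type) (S : U -> U) :
  (forall u v, S u = S v -> u = v) -> (forall v, exists u, S u = v) ->
  two_sided_inverse S (epsilon (inhabits id) (two_sided_inverse S)).
Proof.
move=> injS surS; apply: epsilon_spec.
pose T v := proj1_sig (constructive_indefinite_description _ (surS v)).
have TK : cancel T S.
  by move=> v; exact: proj2_sig (constructive_indefinite_description _ (surS v)).
by exists T; split=> // u; apply: injS.
Qed.

Lemma delta_operator_annihilated (R : realType) (n d : nat)
    (O : 'I_n -> {linear {mpoly R[n]} -> {mpoly R[n]}}) (p : {mpoly R[n]}) :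
  delta_operator O -> (msize p <= d)%N -> annihilated O d p.
Proof.
move=> hO; elim: d p => [|d IHd] p; first by rewrite leqn0 msize_poly_eq0 => /eqP.
by move=> le_p j; apply/IHd/delta_operator_msize.
Qed.

(** E' acts on each Clifford coordinate as the Euler operator, so bijectivity
    is checked there. *)
Lemma I'_inverse (R : realType) (n : nat)
    (O X : 'I_n -> {linear {mpoly R[n]} -> {mpoly R[n]}}) (s : R) :
  delta_operator O -> weyl_heisenberg O X -> 0 < s ->
  two_sided_inverse (fun f : clpoly R n => E' O X f + s *: f) (I' O X s).
Proof.
move=> hO [OO XX OX] s0.
have {}OO j k u : O j (O k u) = O k (O j u) by apply/subr0_eq/OO.
have {}XX j k u : X j (X k u) = X k (X j u) by apply/subr0_eq/XX.
have {}OX j k u : O j (X k u) = X k (O j u) + (j == k)%:R *: u.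
  by rewrite -OX addrC subrK.
have nilO p := delta_operator_annihilated hO (leqnn (msize p)).
apply: bijective_epsilon => [f g|f].
  move/ffunP => fg; apply/ffunP=> A; apply: subr0_eq.
  apply: (euler_shift_inj OO OX s0 (nilO _)); move: (fg A).
  rewrite !ffunE !E'_coord linearB scalerBr /= addrACA -opprD => ->.
  by rewrite subrr.
have /fin_all_exists[g gP] A := euler_shift_surj XX OX s0 (nilO (f A)).
by exists [ffun A => g A]; apply/ffunP=> A; rewrite !ffunE E'_coord ffunE gP.
Qed.

Lemma D'_coord (R : realType) (n : nat)
    (O : 'I_n -> {linear {mpoly R[n]} -> {mpoly R[n]}}) (f : clpoly R n)
    (B : {set 'I_n}) :
  D' O f B = \sum_j \sum_A cl_coef (cl_gen R j * cl_basis R A) B *: O j (f A).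
Proof.
rewrite sum_ffunE; apply: eq_bigr => j _; rewrite ffunE.
by apply: eq_bigr => A _; rewrite ffunE.
Qed.

(** Left multiplication by e_j has scalar matrix entries, which commute with
    the Euler operator; only O_j E = (E + 1)O_j contributes the extra D' f. *)
Lemma D'_euler_shift (R : realType) (n : nat)
    (O X : 'I_n -> {linear {mpoly R[n]} -> {mpoly R[n]}}) (s : R)
    (f : clpoly R n) :
  weyl_heisenberg O X ->
  D' O (E' O X f + s *: f) = E' O X (D' O f) + (s + 1) *: D' O f.
Proof.
move=> [OO _ OX]; apply/ffunP=> B.
rewrite !ffunE E'_coord !D'_coord linear_sum scaler_sumr -big_split.
apply: eq_bigr => j _ /=; rewrite linear_sum scaler_sumr -big_split.
apply: eq_bigr => A _ /=; rewrite !ffunE E'_coord linearD linearZ /= lowering_euler.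
- by rewrite linearZ /= !scalerDr scalerDl scale1r !scalerA (mulrC s) addrAC addrA.
- by move=> i k u; apply/subr0_eq/OO.
- by move=> i k u; rewrite -OX addrC subrK.
Qed.

Theorem lemma3p4 (R : realType) (n : nat) (hn : (0 < n)%N)
    (O X : 'I_n -> {linear {mpoly R[n]} -> {mpoly R[n]}})
    (hO : delta_operator O) (hOX : weyl_heisenberg O X)
    (s : R) (hs : 0 < s) (f : clpoly R n) :
  D' O (I' O X s f) = I' O X (s + 1) (D' O f).
Proof.
have [_ EK] := I'_inverse hO hOX hs.
have [IK _] := I'_inverse hO hOX (addr_gt0 hs ltr01).
by rewrite -[in RHS](EK f) D'_euler_shift // IK.
Qed.
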